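(* The set of invariant states is $\mathbf{J}=\{\theta^w:w_l\le w\le w_u\}$.
   Context: Let $K\in\mathbb{N}$, $\lambda_k,\mu_k\in(0,\infty)$, $\rho_k=\lambda_k/\mu_k$, $\rho=\sum_k\rho_k>1$; $\Gamma_k$ a continuous probability distribution on $(0,\infty)$ with finite mean, $G_k(x)=1-\Gamma_k([0,x])$. Let $w_l=\sup\{u\ge0:\sum_k\rho_kG_k(u)<1\}$ and $w_u=\sup\{u\ge0:\sum_k\rho_kG_k(u)\le1\}$. A workload fluid model solution is $w:[0,\infty)\to\mathbb{R}_+$ with $w(t)=w(0)+\sum_k\rho_k\int_0^tG_k(w(s))ds-t$ for all $t$; for each $w_0\ge0$ there is a unique one with $w(0)=w_0$ (taken as known). $\mathbf{M}_2$ is the set of finite nonnegative Borel measures on $\mathbb{R}_+^2$, $\mathbf{M}_2^K$ its $K$-fold product. For $\vartheta\in\mathbf{M}_2^K$: $\vartheta_+=\sum_k\vartheta_k$, $w_\vartheta=\sup\{x\ge0:\vartheta_+([x,\infty)\times\mathbb{R}_+)>0\}$. For Borel $B\subset\mathbb{R}_+^2$, $x\in\mathbb{R}_+^2$: $B_x=\{y:y-x\in B\}$; $B_t=B_{(t,t)}$. $C=\mathbb{R}_+\times\{0\}\cup\{0\}\times\mathbb{R}_+$. $\mathbf{I}$ is the set of $\vartheta\in\mathbf{M}_2^K$ with $\vartheta_+(C_x)=0$ for all $x\in\mathbb{R}_+^2$, $w_\vartheta<\infty$, and $\max_kG_k(w_\vartheta-\varepsilon)>0$ for all $\varepsilon>0$.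 $\delta^+_x$ is the unit mass at $x$ if $x>0$, zero measure if $x=0$. A fluid model solution with initial measure $\vartheta\in\mathbf{I}$ is $\zeta:[0,\infty)\to\mathbf{M}_2^K$ with $\zeta(0)=\vartheta$ and $\zeta_k(t)(B)=\zeta_k(0)(B_t)+\lambda_k\int_0^t(\delta^+_{w(s)}\times\Gamma_k)(B_{t-s})ds$ for all $k$, Borel $B$, $t\ge0$, where $w$ is the workload fluid model solution with $w(0)=w_\vartheta$; it exists and is unique for every $\vartheta\in\mathbf{I}$. An invariant state is $\theta\in\mathbf{I}$ such that the unique fluid model solution $\zeta$ with $\zeta(0)=\theta$ satisfies $\zeta(t)=\theta$ for all $t\ge0$. For $w_l\le w\le w_u$, $\theta^w\in\mathbf{M}_2^K$ is the unique element such that for each $k$: $\theta^w_k([w,\infty)\times\mathbb{R}_+)=0$ and, for $0\le a<b\le w$ and $0\le c<d\le\infty$, $\theta^w_k([a,b)\times[c,d))=\lambda_k\int_{w-b}^{w-a}\Gamma_k([c+u,d+u))du$.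
   Formalization: The inequalities defining w_l and w_u are reversed: w_l = sup{u≥0: Σρ_kG_k(u) > 1} and w_u = sup{u≥0: Σρ_kG_k(u) ≥ 1}, because as printed both suprema are +∞ (the sum decreases to 0). *)

(* Defs.v *)
From HB Require Import structures.
From mathcomp Require Import all_boot all_order all_algebra.
From mathcomp Require Import all_classical all_reals all_analysis.
Set Implicit Arguments. Unset Strict Implicit. Unset Printing Implicit Defensive.
Import Order.TTheory GRing.Theory Num.Theory.
Import numFieldNormedType.Exports.
Local Open Scope classical_set_scope.
Local Open Scope ring_scope.
Local Open Scope ereal_scope.

(* Elements of M_2: finite nonnegative Borel measures on R_+^2, represented as
   finite measures on R x R (product Borel sigma-algebra) that give zero mass
   outside R_+^2 (see is_M2K). *)
Definition M2 (R : realType) := {finite_measure set (R * R)%type -> \bar R}.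

Section Defs.
Variables (R : realType) (K : nat) (lam mu : 'I_K -> R) (Gam : 'I_K -> probability R R).

Definition Rplus2 : set (R * R) := [set x | (0 <= x.1)%R /\ (0 <= x.2)%R].

Definition Gsurv (k : 'I_K) (x : R) : R :=
  (1 - fine (Gam k [set y | (0 <= y)%R /\ (y <= x)%R]))%R.

Definition rho (k : 'I_K) : R := (lam k / mu k)%R.

Definition Ssum (u : R) : R := (\sum_(k < K) rho k * Gsurv k u)%R.

Definition w_low : R := sup [set u | (0 <= u)%R /\ (1 < Ssum u)%R].
Definition w_up : R := sup [set u | (0 <= u)%R /\ (1 <= Ssum u)%R].

Definition workload_sol (w : R -> R) : Prop :=
  (forall t, (0 <= t)%R -> (0 <= w t)%R) /\
  forall t, (0 <= t)%R ->
    (w t)%:E = (w 0%R)%:E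
      + \sum_(k < K) (rho k)%:E *
          \int[lebesgue_measure]_(s in [set s : R | (0 <= s <= t)%R]) (Gsurv k (w s))%:E
      - t%:E.

Definition is_M2K (th : 'I_K -> M2 R) : Prop :=
  forall k, th k (~` Rplus2) = 0.

Definition shift (B : set (R * R)) (x : R * R) : set (R * R) :=
  [set y | B ((y.1 - x.1)%R, (y.2 - x.2)%R)].

Definition thplus (th : 'I_K -> M2 R) (A : set (R * R)) : \bar R :=
  \sum_(k < K) th k A.

Definition Cset : set (R * R) :=
  [set y | ((0 <= y.1)%R /\ y.2 = 0%R) \/ (y.1 = 0%R /\ (0 <= y.2)%R)].

(* w_theta = sup{x >= 0 : theta_+([x,oo) x R_+) > 0}, with sup of the empty set = 0 *)
Definition wtheta (th : 'I_K -> M2 R) : \bar R :=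
  ereal_sup (EFin @` [set x : R | (0 <= x)%R /\
     (x = 0%R \/ 0 < thplus th [set y | (x <= y.1)%R /\ (0 <= y.2)%R])]).

Definition inI (th : 'I_K -> M2 R) : Prop :=
  is_M2K th /\
  (forall x, Rplus2 x -> thplus th (shift Cset x) = 0) /\
  wtheta th < +oo /\
  (forall eps : R, (0 < eps)%R -> exists k, (0 < Gsurv k (fine (wtheta th) - eps))%R).

(* (delta^+_x  x  Gamma)(C): the product of the unit mass at x (zero measure if
   x = 0) with Gamma, evaluated on C, i.e. Gamma of the section of C at x. *)
Definition dplus_prod (x : R) (k : 'I_K) (C : set (R * R)) : \bar R :=
  if (0 < x)%R then Gam k [set y | C (x, y)] else 0.

Definition fluid_solution (th : 'I_K -> M2 R) (zeta : R -> 'I_K -> M2 R) : Prop :=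
  (forall t, (0 <= t)%R -> is_M2K (zeta t)) /\
  zeta 0%R = th /\
  exists w : R -> R, workload_sol w /\ (w 0%R)%:E = wtheta th /\
    forall (k : 'I_K) (B : set (R * R)) (t : R),
      measurable B -> B `<=` Rplus2 -> (0 <= t)%R ->
      zeta t k B = zeta 0%R k (shift B (t, t))
        + (lam k)%:E * \int[lebesgue_measure]_(s in [set s : R | (0 <= s <= t)%R])
                          dplus_prod (w s) k (shift B ((t - s)%R, (t - s)%R)).

(* invariant state: th in I and the (unique, by the known uniqueness) fluid model
   solution started at th is constant equal to th *)
Definition invariant_state (th : 'I_K -> M2 R) : Prop :=
  inI th /\ fluid_solution th (fun _ => th).

Definition is_theta_w (w : R) (th : 'I_K -> M2 R) : Prop :=
  is_M2K th /\
  forall k : 'I_K,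
    th k [set y | (w <= y.1)%R /\ (0 <= y.2)%R] = 0 /\
    forall (a b c : R) (d : \bar R),
      (0 <= a)%R -> (a < b)%R -> (b <= w)%R -> (0 <= c)%R -> c%:E < d ->
      th k [set y | (a <= y.1)%R /\ (y.1 < b)%R /\ (c <= y.2)%R /\ y.2%:E < d]
      = (lam k)%:E * \int[lebesgue_measure]_(u in [set u : R | (w - b <= u <= w - a)%R])
                       Gam k [set y | (c + u <= y)%R /\ (y - u)%:E < d].

End Defs.

(* Main.v *)
(* In an invariant state the fluid equation balances, for every set B, the mass of
   B against the mass of B shifted along the diagonal plus the arrivals into B.
   Applied to half planes [x, oo) x R_+, it forces the workload to stay at
   W = w_theta: a drop below W would empty every half plane [x, oo) x R_+ with x
   slightly below W, and an excess over W would create mass above W. A constant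
   workload W solves the workload equation iff sum_k rho_k G_k(W) = 1, that is, by
   continuity and monotonicity, iff w_l <= W <= w_u. Letting a rectangle drift
   along the diagonal until it lies above level W leaves only the arrival term,
   which is the formula defining theta^W. Conversely, the rectangle formula extends
   to theta_k(B) = lam_k int_0^oo Gam_k{y | (w - u, y - u) in B} du for all Borel
   B, and splitting this integral at u = t is the fluid equation for the constant
   solution. *)
Require Import Defs.
From HB Require Import structures.
From mathcomp Require Import all_boot all_order all_algebra.
From mathcomp Require Import all_classical all_reals all_analysis.
From mathcomp Require Import measurable_realfun lra.
Import Order.TTheory GRing.Theory Num.Theory.
Import numFieldNormedType.Exports.
Local Open Scope classical_set_scope.
Local Open Scope ring_scope.

(* mathcomp-analysis has another [shift]. *)
Local Notation shift := Defs.shift.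

(* Workload solutions are not assumed measurable, so measurability of the
   integrands is not available when this is applied. *)
Lemma ge0_le_integral_nonmeasurable {d} {T : measurableType d} {R : realType}
    (m : {measure set T -> \bar R}) (D E : set T) (f g : T -> \bar R) :
  (forall x, D x -> (0 <= f x)%E) -> (forall x, E x -> (0 <= g x)%E) ->
  (forall x, D x -> E x /\ (f x <= g x)%E) ->
  (\int[m]_(x in D) f x <= \int[m]_(x in E) g x)%E.
Proof.
move=> f0 g0 fg; rewrite ge0_integralE// ge0_integralE//.
apply: le_ereal_sup => _ [h /= hf <-]; exists h => //= x.
apply: (le_trans (hf x)); rewrite /patch.
case: ifPn => [/set_mem Dx|_].
  by have [Ex fgx] := fg _ Dx; rewrite (mem_set Ex).
by case: ifPn => // /set_mem; exact: g0.
Qed.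

(** * Reflections and translations of Lebesgue integrals *)

Lemma lebesgue_measure_reflection {R : realType} (c : R) (A : set R) :
  measurable A ->
  pushforward lebesgue_measure (fun x : R => c - x : measurableTypeR R) A
  = lebesgue_measure A.
Proof.
have mc : measurable_fun setT (fun x : R => c - x : measurableTypeR R).
  by apply: measurable_funB => //; exact: measurable_cst.
move=> mA; apply/esym.
have := @lebesgue_measure_unique R
  (pushforward lebesgue_measure (fun x : R => c - x : measurableTypeR R)).
move=> /(_ mc _ A mA); apply => _ [[a b]] _ <-.
rewrite -[RHS]/(lebesgue_measure ((fun x : R => c - x) @^-1` `]a, b])).
(* Reflection exchanges the open and the closed end of the interval, which does not change its
   length. *)
rewrite (_ : _ @^-1` _ = `[c - b, c - a[%classic).
  rewrite !lebesgue_measure_itv/= !lte_fin ltrD2l ltrN2.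
  by case: ifPn => // _; rewrite -!EFinB; congr (_%:E); lra.
by apply/seteqP; split => x /=; rewrite !in_itv /=; lra.
Qed.

Lemma ge0_integral_reflection {R : realType} (c : R) (D : set R)
    (h : R -> \bar R) :
  measurable D -> measurable_fun setT h -> (forall x, (0 <= h x)%E) ->
  (\int[lebesgue_measure]_(x in [set x | D (c - x)%R]) h (c - x)%R
   = \int[lebesgue_measure]_(x in D) h x)%E.
Proof.
move=> mD mh h0.
have mc : measurable_fun [set: measurableTypeR R]
    (fun x : measurableTypeR R => c - (x : R) : measurableTypeR R).
  by apply: measurable_funB => //; exact: measurable_cst.
have := @ge0_integral_pushforward _ _ _ _ R _ mc lebesgue_measure D h mD.
move=> <- //; last exact: measurable_funTS.
by apply: eq_measure_integral => A mA _; exact: lebesgue_measure_reflection.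
Qed.

(** A translation is the composition of two reflections. *)
Lemma ge0_integral_translation {R : realType} (c : R) (D : set R)
    (h : R -> \bar R) :
  measurable D -> measurable_fun setT h -> (forall x, (0 <= h x)%E) ->
  (\int[lebesgue_measure]_(x in [set x | D (x + c)%R]) h (x + c)%R
   = \int[lebesgue_measure]_(x in D) h x)%E.
Proof.
move=> mD mh h0.
have mN : measurable_fun setT (fun x : R => 0 - x).
  by apply: measurable_funB => //; exact: measurable_cst.
rewrite -[RHS](ge0_integral_reflection 0)//.
rewrite -[RHS](ge0_integral_reflection (- c))//.
- congr (integral _ _ _); first by apply/seteqP; split => x /=;
    rewrite sub0r opprB opprK.
  by apply/funext => x; rewrite sub0r opprB opprK.
- by rewrite -[X in measurable X]setTI; exact: mN.
- exact: measurableT_comp mN.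
Qed.

(** * A generator of the Borel sets of the plane, and atomless probabilities *)

(** Supplies the generator on which two measures are compared in [theta_w_diag_mass]. It is large
    enough because it makes both projections measurable: the preimage of a ray is a countable union
    of quadrants. *)
Lemma measurable_prod_rays {R : realType} :
  (measurable : set (set (R * R))) =
  <<s [set A | exists x y : R, A = `[x, +oo[ `*` `[y, +oo[] >>.
Proof.
set G := (X in <<s X >>).
apply/seteqP; split; last first.
  apply: smallest_sub; first exact: sigma_algebra_measurable.
  by move=> _ [x [y ->]]; apply: measurableX.
have ray_bigcup : \bigcup_n `[- (n%:R : R), +oo[%classic = [set: R].
  apply/seteqP; split => // x _; exists (Num.truncn `|x|).+1 => //=.
  rewrite in_itv/= andbT lerNl (le_trans (ler_norm _))// normrN.
  by rewrite ltW// truncnS_gt.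
apply: smallest_sub; first exact: smallest_sigma_algebra.
have Grays x y : <<s G >> (`[x, +oo[ `*` `[y, +oo[).
  by apply: sub_sigma_algebra; exists x, y.
rewrite subUset; split => _ [A mA <-].
- suff : measurable_fun [set: g_sigma_algebraType G] (fst : _ -> R) by apply.
  apply: (measurability _ (RGenCInfty.measurableE R)) => _ [_ [x ->] <-].
  rewrite (_ : _ `&` _ = \bigcup_n (`[x, +oo[ `*` `[- n%:R, +oo[)).
    apply: (@bigcupT_measurable _ (g_sigma_algebraType G)) => n; exact: Grays.
  rewrite -setX_bigcupr ray_bigcup setTI.
  by apply/seteqP; split => [|] [u v] //= [].
- suff : measurable_fun [set: g_sigma_algebraType G] (snd : _ -> R) by apply.
  apply: (measurability _ (RGenCInfty.measurableE R)) => _ [_ [x ->] <-].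
  rewrite (_ : _ `&` _ = \bigcup_n (`[- n%:R, +oo[ `*` `[x, +oo[)).
    apply: (@bigcupT_measurable _ (g_sigma_algebraType G)) => n; exact: Grays.
  rewrite -setX_bigcupl ray_bigcup setTI.
  by apply/seteqP; split => [|] [u v] //= [].
Qed.

(** Continuity from above along the intervals [F n], which shrink to the point. *)
Lemma probability_small_itv {R : realType} (P : probability R R) (x : R) :
  P [set x] = 0%E -> forall e : R, 0 < e ->
  exists2 d : R, 0 < d & (P `[(x - d)%R, (x + d)%R]%classic < e%:E)%E.
Proof.
move=> Px e e0.
pose F n : set R := `[x - n.+1%:R^-1, x + n.+1%:R^-1]%classic.
have FE : \bigcap_n F n = [set x].
  apply/seteqP; split => [y Fy|_ ->].
    apply/eqP; rewrite -subr_eq0 -normr_le0; apply/ler_addgt0Pr => r r0.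
    rewrite add0r; have [n _ /(_ n (leqnn n)) nr] := near_infty_natSinv_lt (PosNum r0).
    apply: le_trans (ltW nr); rewrite ler_distl.
    by have := Fy n I; rewrite /F/= in_itv.
  by move=> n _; rewrite /F/= in_itv/= lerBlDr lerDl invr_ge0 ler0n.
have F0 n : measurable (F n) by exact: measurable_itv.
have Fdec : {homo F : n m / (n <= m)%N >-> (m <= n)%O}.
  move=> n m nm; apply/subsetPset => y; rewrite /F/= !in_itv/=.
  have : m.+1%:R^-1 <= n.+1%:R^-1 :> R by rewrite lef_pV2 ?posrE// ler_nat.
  by move: (n.+1%:R^-1) (m.+1%:R^-1) => u v; lra.
have : (P \o F) n @[n --> \oo] --> 0%E.
  rewrite -Px -FE; apply: nonincreasing_cvg_mu => //.
    by rewrite ltey_eq fin_num_measure.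
  by rewrite FE; exact: measurable_set1.
move/fine_cvgP => [_ /cvgr_lt/(_ _ e0)[n _ /(_ n (leqnn n))/= Fn]].
by exists n.+1%:R^-1 => //; rewrite -[ltLHS]fineK ?lte_fin ?fin_num_measure.
Qed.

(** * Survival functions and the level set [Ssum = 1] *)

Section Survival.
Context {R : realType} {K : nat} {Gam : 'I_K -> probability R R}.
Hypothesis Gam_neg : forall k, Gam k [set x : R | x <= 0] = 0%E.
Local Notation G := (Gsurv Gam).

(** The negative half-line is null, so removing [[0, x]] or []-oo, x]] leaves the same mass.
    Properties of [G] thus reduce to those of a measure on rays. *)
Lemma GsurvE k x : (G k x)%:E = Gam k `]x, +oo[%classic.
Proof.
have mneg : measurable [set y : R | y <= 0].
  by rewrite -[X in measurable X]/[set` `]-oo, 0]]; exact: measurable_itv.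
have -> : `]x, +oo[%classic = ~` `]-oo, x]%classic :> set R by rewrite setCitvl.
rewrite probability_setC//.
have cap0 : Gam k (`]-oo, x]%classic `&` [set y | y < 0]) = 0%E.
  apply: (subset_measure0 _ mneg _ (Gam_neg k)) => [|y [_ /ltW]//].
  apply: measurableI => //.
  by rewrite -[X in measurable X]/[set` `]-oo, 0[]; exact: measurable_itv.
rewrite /Gsurv EFinB; congr (1 - _)%E.
rewrite (_ : [set y | _ /\ _] = `[0, x]%classic); last first.
  by apply/seteqP; split => y /=; rewrite in_itv/=; [case=> -> ->|move/andP].
rewrite fineK ?fin_num_measure//.
rewrite (_ : `]-oo, x]%classic =
    `[0, x]%classic `|` (`]-oo, x]%classic `&` [set y | y < 0])); last first.
  apply/seteqP; split => y /=; rewrite !in_itv/=.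
    by move=> yx; have [y0|y0] := leP 0 y; [left; apply/andP|right].
  by case=> [/andP[]|[]].
rewrite measureU//; first by rewrite [X in (_ + X)%E]cap0 adde0.
- apply: measurableI => //.
  by rewrite -[X in measurable X]/[set` `]-oo, 0[]; exact: measurable_itv.
- apply/seteqP; split => y //= [] /[swap] -[_].
  by rewrite in_itv/= => y0 /andP[]; rewrite leNgt y0.
Qed.

Lemma Gsurv_ge0 k x : 0 <= G k x.
Proof. by rewrite -lee_fin GsurvE. Qed.

Lemma Gsurv_nonincreasing k x y : x <= y -> G k y <= G k x.
Proof.
move=> xy; rewrite -lee_fin !GsurvE; apply: le_measure; rewrite ?inE//.
by apply: subset_itvr; rewrite bnd_simp.
Qed.

Lemma Gsurv_at0 k : G k 0 = 1.
Proof.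
apply/EFin_inj; rewrite GsurvE -[`]0, +oo[%classic]setCK setCitvr.
rewrite probability_setC// (_ : `]-oo, 0]%classic = [set x | x <= 0])//.
by rewrite Gam_neg sube0.
Qed.

Lemma Gsurv_lt k (e : R) : 0 < e -> exists2 u, 0 <= u & G k u < e.
Proof.
move=> e0.
have Fcap : \bigcap_n `](n%:R : R), +oo[%classic = set0.
  apply/seteqP; split => // x /(_ (Num.truncn `|x|).+1 I)/=.
  rewrite in_itv/= andbT ltNge => /negP; apply.
  by rewrite (le_trans (ler_norm _))// ltW// truncnS_gt.
have : (Gam k \o (fun n : nat => `](n%:R : R), +oo[%classic)) n @[n --> \oo] --> 0%E.
  rewrite -(measure0 (Gam k)) -Fcap; apply: nonincreasing_cvg_mu => //.
  - by rewrite ltey_eq fin_num_measure.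
  - by rewrite Fcap.
  - move=> n m nm; apply/subsetPset; apply: subset_itvr.
    by rewrite bnd_simp ler_nat.
move/fine_cvgP => [_ /cvgr_lt/(_ _ e0)[n _ /(_ n (leqnn n))/= Fn]].
by exists n%:R => //; rewrite -GsurvE in Fn.
Qed.

Hypothesis Gam_atomless : forall k (x : R), Gam k [set x] = 0%E.

Lemma Gsurv_continuous k : continuous (G k).
Proof.
move=> x; apply/cvgrPdist_le => e e0.
have [d d0 Pd] := probability_small_itv (Gam k) x (Gam_atomless k x) e e0.
(* The drop of [G k] from [u] to [v] is the mass of []u, v]], which lies in the small interval
   around [x]. *)
have Gdiff u v : x - d <= u -> u <= v -> v <= x + d -> G k u <= G k v + e.
  move=> du uv vd; rewrite -lee_fin (EFinD (G k v) e) !GsurvE.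
  rewrite [X in (Gam k X <= _)%E](_ : _ = `]v, +oo[%classic `|` `]u, v]%classic); last first.
    apply/seteqP; split => y /=; rewrite !in_itv/= ?andbT.
      by move=> uy; have [yv|yv] := leP y v; [right; apply/andP|left].
    by case=> [|/andP[]//]; exact: le_lt_trans.
  apply: le_trans (measureU2 _ _ _) _ => //; rewrite leeD2l//.
  apply: le_trans (ltW Pd); apply: le_measure; rewrite ?inE//.
  by move=> y /=; rewrite !in_itv/= => /andP[? ?]; lra.
near=> y; have : `|x - y| <= d by near: y; exact: cvgr_dist_le.
rewrite ler_distl => /andP[h1 h2]; rewrite ler_distl.
case: (leP x y) => xy.
  have := Gdiff x y; have := Gsurv_nonincreasing k _ _ xy.
  by move=> ? /(_ _ xy _); lra.
have := Gdiff y x; have := Gsurv_nonincreasing k _ _ (ltW xy).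
by move=> ? /(_ _ (ltW xy) _); lra.
Unshelve. all: by end_near. Qed.

Context {lam mu : 'I_K -> R}.
Hypothesis lam_gt0 : forall k, 0 < lam k.
Hypothesis mu_gt0 : forall k, 0 < mu k.
Hypothesis rho_gt1 : 1 < \sum_(k < K) lam k / mu k.
Local Notation S := (Ssum lam mu Gam).

Lemma rho_gt0 k : 0 < rho lam mu k.
Proof. exact: divr_gt0. Qed.

Lemma Ssum_nonincreasing x y : x <= y -> S y <= S x.
Proof.
move=> xy; apply: ler_sum => k _.
by rewrite ler_wpM2l ?Gsurv_nonincreasing// ltW// rho_gt0.
Qed.

Lemma Ssum_at0 : 1 < S 0.
Proof. by rewrite /Ssum; under eq_bigr do rewrite Gsurv_at0 mulr1. Qed.

Lemma Ssum_continuous : continuous S.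
Proof.
apply: (@continuous_big _ _ +%R) => [|k _ x]; first exact: add_continuous.
by apply: cvgM; [exact: cvg_cst|exact: Gsurv_continuous].
Qed.

(** Bounds the sets whose suprema are [w_low] and [w_up], so that these are genuine suprema. *)
Lemma Ssum_lt1 : exists2 u, 0 <= u & S u < 1.
Proof.
pose r := \sum_(k < K) lam k / mu k.
have r0 : 0 < r by exact: lt_trans rho_gt1.
have /choice[u Hu] (k : 'I_K) : exists u, 0 <= u /\ G k u < r^-1.
  by have [u u0 Gu] := Gsurv_lt k r^-1 ltac:(by rewrite invr_gt0); exists u.
(* The sum dominates each [u k], so by monotonicity every [G k] is below [r^-1] there. *)
exists (\sum_k u k).
  by apply: sumr_ge0 => k _; exact: (Hu k).1.
have S_lt k : rho lam mu k * G k (\sum_i u i) < rho lam mu k * r^-1.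
  rewrite ltr_pM2l ?rho_gt0//; apply: le_lt_trans (Hu k).2.
  apply: Gsurv_nonincreasing; rewrite (bigD1 k)//= lerDl sumr_ge0// => i _.
  exact: (Hu i).1.
rewrite -(divff (lt0r_neq0 r0)) mulr_suml /Ssum.
case: (pickP (fun _ : 'I_K => true)) => [k0 _|no]; last first.
  by move: r0; rewrite /r big1 ?ltxx// => k; have := no k.
apply: ltr_sum => [|k _]; last exact: S_lt.
by apply/hasP; exists k0; rewrite ?mem_index_enum.
Qed.

(** If [S w > 1], continuity keeps [S > 1] slightly to the right of [w], so [w < w_low]; if
    [S w < 1], then [S < 1] already slightly to the left, so [w_up < w]. The value [w = 0] is
    excluded by [S 0 > 1]. *)
Lemma w_low_up_Ssum w :
  w_low lam mu Gam <= w <= w_up lam mu Gam <-> 0 < w /\ S w = 1.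
Proof.
have [M M0 SM] := Ssum_lt1.
have SM' u : 1 <= S u -> u <= M.
  by move=> Su; rewrite leNgt; apply/negP => /ltW/Ssum_nonincreasing; lra.
have supl : has_sup [set u | 0 <= u /\ 1 < S u].
  split; first by exists 0; split => //; exact: Ssum_at0.
  by exists M => u [_ /ltW/SM'].
have supu : has_sup [set u | 0 <= u /\ 1 <= S u].
  split; first by exists 0; split => //; exact/ltW/Ssum_at0.
  by exists M => u [_ /SM'].
split=> [/andP[lw wu]|[w0 Sw]]; last first.
  apply/andP; split.
    apply: ge_sup => [|u [_ Su]]; first by case: supl.
    by rewrite leNgt; apply/negP => /ltW/Ssum_nonincreasing; lra.
  by apply: ub_le_sup; [case: supu|split; rewrite ?Sw// ltW].
have w_ge0 : 0 <= w.
  apply: le_trans lw; apply: ub_le_sup; first by case: supl.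
  by split => //; exact: Ssum_at0.
have Sw : S w = 1.
  apply/eqP; rewrite eq_le; apply/andP; split; rewrite leNgt; apply/negP => Sw.
    have [d /= d0 /(_ (w + d / 2)) Hd] : \forall y \near w, 1 < S y.
      exact: (cvgr_gt _ (Ssum_continuous w) _ Sw).
    have : w + d / 2 <= w_low lam mu Gam.
      apply: ub_le_sup; first by case: supl.
      split; first lra; apply: Hd.
      by rewrite /ball/= opprD addrA subrr sub0r normrN gtr0_norm; lra.
    lra.
  have [d /= d0 Hd] : \forall y \near w, S y < 1.
    exact: (cvgr_lt _ (Ssum_continuous w) _ Sw).
  have : w_up lam mu Gam <= w - d / 2.
    apply: ge_sup => [|u [_ Su]]; first by case: supu.
    rewrite leNgt; apply/negP => uw.
    have : S (w - d / 2) < 1.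
      apply: Hd; rewrite /ball/= opprB addrC subrK gtr0_norm; lra.
    by have := Ssum_nonincreasing _ _ (ltW uw); lra.
  lra.
split => //; rewrite lt_neqAle w_ge0 andbT; apply/eqP => w0.
by move: Sw; rewrite -w0 => Sw; have := Ssum_at0; rewrite Sw ltxx.
Qed.

End Survival.

(** * Sections of plane sets along the diagonal *)

Section DiagonalSections.
Context {R : realType}.
Implicit Types (B : set (R * R)) (P : probability R R) (w u : R).

(* A job arriving at [(w, y)] has moved to [(w - u, y - u)] after [u] units of time. *)
Definition diag_section B w u : set R := [set y | B (w - u, y - u)].

Let shear_measurable w :
  measurable_fun setT (fun x : R * R => (w - x.1, x.2 - x.1)).
Proof.
apply: measurable_fun_pair; apply: measurable_funB => //; exact: measurable_cst.
Qed.

(** A shear turns diagonal sections into ordinary sections of a product set, whose measure depends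
    measurably on [u]. *)
Let diag_sectionE B w u :
  diag_section B w u =
  xsection ((fun x : R * R => (w - x.1, x.2 - x.1)) @^-1` B) u.
Proof. by apply/seteqP; split => y /=; rewrite xsectionE. Qed.

Lemma measurable_diag_section B w u :
  measurable B -> measurable (diag_section B w u).
Proof.
move=> mB; rewrite diag_sectionE; apply: measurable_xsection.
by rewrite -[X in measurable X]setTI; exact: shear_measurable.
Qed.

Lemma measurable_fun_diag_section B P w :
  measurable B -> measurable_fun setT (fun u => P (diag_section B w u)).
Proof.
move=> mB; under eq_fun do rewrite diag_sectionE.
apply: (measurable_fun_xsection P).
by rewrite -[X in measurable X]setTI; exact: shear_measurable.
Qed.

Lemma measurable_shift B (x : R * R) : measurable B -> measurable (shift B x).
Proof.
move=> mB.
have mx : measurable_fun setT (fun y : R * R => (y.1 - x.1, y.2 - x.2)).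
  apply: measurable_fun_pair; apply: measurable_funB => //; exact: measurable_cst.
by rewrite -[X in measurable X]setTI; exact: mx.
Qed.

Lemma measurable_Rplus2 : measurable (@Rplus2 R).
Proof.
rewrite (_ : @Rplus2 R = `[0, +oo[%classic `*` `[0, +oo[%classic).
  exact: measurableX.
by apply/seteqP; split => -[x y] /=; rewrite !in_itv/= !andbT.
Qed.

Lemma measurable_quadrant (a b : R) :
  measurable [set y : R * R | a <= y.1 /\ b <= y.2].
Proof.
rewrite (_ : [set y | _] = `[a, +oo[%classic `*` `[b, +oo[%classic).
  exact: measurableX.
by apply/seteqP; split => -[x y] /=; rewrite !in_itv/= !andbT.
Qed.

Definition rectangle (a b c : R) (d : \bar R) : set (R * R) :=
  [set y | a <= y.1 /\ y.1 < b /\ c <= y.2 /\ (y.2%:E < d)%E].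

Lemma measurable_rectangle (a b c : R) (d : \bar R) :
  measurable (rectangle a b c d).
Proof.
rewrite /rectangle (_ : [set y | _] =
    `[a, b[%classic `*` (`[c, +oo[%classic `&` [set y : R | (y%:E < d)%E])).
  apply: measurableX => //; apply: measurableI => //.
  case: d => [d| |].
  - have -> : [set y : R | (y%:E < d%:E)%E] = `]-oo, d[%classic.
      by apply/seteqP; split => y /=; rewrite in_itv/= lte_fin.
    exact: measurable_itv.
  - have -> : [set y : R | (y%:E < +oo)%E] = setT; last exact: measurableT.
    by apply/seteqP; split => y //= _; exact: ltry.
  - have -> : [set y : R | (y%:E < -oo)%E] = set0; last exact: measurable0.
    by apply/seteqP; split => y.
apply/seteqP; split => -[x y] /=; rewrite !in_itv/= ?andbT.
  by move=> [-> [-> [-> ->]]].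
by move=> [/andP[-> ->] [-> ->]].
Qed.

(** The section is empty unless [a <= w - u < b], so any domain [D] containing []w - b, w - a]]
    gives the same integral. The added endpoint [w - b] is a null set. *)
Lemma integral_diag_section_rectangle P w (a b c : R) (d : \bar R) (D : set R) :
  (forall u, w - b < u -> u <= w - a -> D u) ->
  (\int[lebesgue_measure]_(u in D) P (diag_section (rectangle a b c d) w u) =
   \int[lebesgue_measure]_(u in [set u : R | w - b <= u <= w - a]%R)
     P [set y | c + u <= y /\ ((y - u)%:E < d)%E]%R)%E.
Proof.
move=> wD.
have rays_measurable : measurable [set y : R * R | c <= y.2 /\ (y.2%:E < d)%E].
  rewrite (_ : [set y | _] = \bigcup_n rectangle (- n%:R) n%:R c d).
    by apply: bigcupT_measurable => n; exact: measurable_rectangle.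
  apply/seteqP; split => [[x y] /= [cy yd]|[x y] [n _] /= [_ [_ ?]]//].
  exists (Num.truncn `|x|).+1 => //=.
  have := truncnS_gt `|x|; rewrite ltr_norml => /andP[h1 h2].
  by split; [exact: ltW|].
transitivity (\int[lebesgue_measure]_(u in `](w - b)%R, (w - a)%R])
     P [set y | c + u <= y /\ ((y - u)%:E < d)%E]%R)%E; last first.
  rewrite integral_itv_obnd_cbnd; first by congr (integral _ _ _);
    apply/seteqP; split => u /=; rewrite in_itv.
  apply: measurable_funTS.
  (* The integrand is the measure of the sections of a horizontal strip, hence measurable in [u]. *)
  rewrite (_ : (fun u => _) =
    (fun u => P (diag_section [set y : R * R | c <= y.2 /\ (y.2%:E < d)%E] w u))).
    exact: measurable_fun_diag_section.
  apply/funext => u; congr (P _).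
  by apply/seteqP; split => y; rewrite /diag_section/= => -[h hd]; split => //; lra.
rewrite integral_mkcond [RHS]integral_mkcond; apply: eq_integral => u _.
rewrite /patch.
have [/set_mem/=|uI] := boolP (u \in [set` _]).
  rewrite in_itv/= => /andP[h1 h2]; rewrite mem_set; last exact: wD.
  congr (P _); apply/seteqP; split => y; rewrite /diag_section/rectangle/=.
    by move=> [? [? [? ?]]]; split => //; lra.
  by move=> [? ?]; do !split => //; lra.
case: ifP => // _; rewrite (_ : diag_section _ _ _ = set0) ?measure0//.
apply/seteqP; split => y //; rewrite /diag_section/rectangle/= => -[h1 [h2 _]].
move/negP: uI; apply; apply/mem_set => /=; rewrite in_itv/=.
by apply/andP; split; lra.
Qed.

End DiagonalSections.

(** * Mass above and below the level [wtheta] *)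

Section Support.
Context {R : realType} {K : nat}.
Implicit Types th : 'I_K -> M2 R.

Lemma thplus_eq0 th A : thplus th A = 0%E -> forall k, th k A = 0%E.
Proof.
move=> th0 k; apply/eqP; rewrite eq_le measure_ge0 andbT -th0.
by rewrite /thplus (bigD1 k)//= leeDl// sume_ge0.
Qed.

Lemma gt_wtheta th (W : R) k x : wtheta th = W%:E -> 0 <= x -> W < x ->
  th k [set y | x <= y.1 /\ 0 <= y.2] = 0%E.
Proof.
move=> thW x0 Wx; apply: thplus_eq0; apply/eqP; rewrite eq_le.
rewrite sume_ge0// andbT leNgt; apply/negP => pos.
have : (x%:E <= W%:E)%E.
  by rewrite -thW; apply: ereal_sup_ubound; exists x => //; split=> //; right.
by rewrite lee_fin leNgt Wx.
Qed.

Lemma lt_wtheta th (W : R) x : wtheta th = W%:E -> 0 <= x -> x < W ->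
  exists k, th k [set y | x <= y.1 /\ 0 <= y.2] <> 0%E.
Proof.
move=> thW x0 xW.
have : (x%:E < wtheta th)%E by rewrite thW lte_fin.
move=> /ereal_sup_gt[_ [y [y0 yth] <-]]; rewrite lte_fin => xy.
(* The point 0 is in the set only to give the empty supremum the value 0; here [y > x >= 0]. *)
case: yth => [yE|]; first by move: xy; rewrite yE ltNge x0.
apply: contraPP => /forallNP th0; apply/negP; rewrite -leNgt.
rewrite /thplus big1// => k _; have /contrapT thk := th0 k.
apply: subset_measure0 thk; try exact: measurable_quadrant.
by move=> z /= [yz z0]; split => //; lra.
Qed.

End Support.

(** * Workload solutions *)

Section Workload.
Context {R : realType} {K : nat} {Gam : 'I_K -> probability R R}.
Context {lam mu : 'I_K -> R}.
Hypothesis Gam_neg : forall k, Gam k [set x : R | x <= 0] = 0%E.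
Hypothesis lam_gt0 : forall k, 0 < lam k.
Hypothesis mu_gt0 : forall k, 0 < mu k.

(** [w t + t] is the initial workload plus the work arrived by time [t], and arrivals are
    nonnegative: the workload drains at most at unit rate. *)
Lemma workload_sol_incr w s t : workload_sol lam mu Gam w ->
  0 <= s -> s <= t -> w s + s <= w t + t.
Proof.
move=> [w_ge0 weq] s0 st; rewrite -lee_fin !EFinD (weq s)// (weq t); last lra.
rewrite !subeK// leeD2l//; apply: lee_sum => k _.
apply: lee_wpmul2l; first by rewrite lee_fin ltW// rho_gt0.
apply: ge0_le_integral_nonmeasurable => u /=; rewrite ?lee_fin ?Gsurv_ge0//.
by move=> /andP[u0 us]; split => //; rewrite u0/= (le_trans us).
Qed.

Lemma integral_cst_itv (t c : R) : 0 <= t ->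
  (\int[lebesgue_measure]_(s in [set s : R | 0 <= s <= t]%R) c%:E = (c * t)%:E)%E.
Proof.
move=> t0; rewrite (_ : [set s | _] = `[0%R, t]%classic); last first.
  by apply/seteqP; split => s /=; rewrite in_itv.
rewrite integral_cst//= lebesgue_measure_itv/= lte_fin.
by case: ltP => [_|t0']; rewrite ?sube0 ?EFinM// (_ : t = 0) ?mulr0 ?mule0//; lra.
Qed.

(** At a constant level the work arriving by time [t] is [Ssum lam mu Gam W * t], which has to
    cancel the drained amount [t]. *)
Lemma workload_sol_cst w (W : R) : (forall t, 0 <= t -> w t = W) -> 0 <= W ->
  workload_sol lam mu Gam w <-> Ssum lam mu Gam W = 1.
Proof.
move=> wW W0.
have drift t : 0 <= t -> (\sum_(k < K) (rho lam mu k)%:E *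
    \int[lebesgue_measure]_(s in [set s : R | 0 <= s <= t]%R) (Gsurv Gam k (w s))%:E
    = (Ssum lam mu Gam W * t)%:E)%E.
  move=> t0; rewrite /Ssum mulr_suml -sumEFin; apply: eq_bigr => k _.
  rewrite -mulrA (EFinM (rho lam mu k)) -(integral_cst_itv t (Gsurv Gam k W))//.
  congr (_ * _)%E.
  by apply: eq_integral => s /set_mem/= /andP[s0 _]; rewrite wW.
split => [[_ /(_ 1 ler01)]|SW].
  rewrite drift// !wW// mulr1 => /(congr1 fine)/=; lra.
split => [t t0|t t0]; first by rewrite wW.
rewrite drift// !wW// SW mul1r.
by transitivity ((W + t - t)%:E) => //; congr EFin; lra.
Qed.

End Workload.

(** * Every invariant state is some [theta^w] *)

Section InvariantStates.
Context {R : realType} {K : nat} {Gam : 'I_K -> probability R R}.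
Context {lam mu : 'I_K -> R}.
Hypothesis lam_gt0 : forall k, 0 < lam k.
Hypothesis mu_gt0 : forall k, 0 < mu k.
Hypothesis rho_gt1 : 1 < \sum_(k < K) lam k / mu k.
Hypothesis Gam_neg : forall k, Gam k [set x : R | x <= 0] = 0%E.
Hypothesis Gam_atomless : forall k (x : R), Gam k [set x] = 0%E.

(** The evolution equation of [fluid_solution] for a constant [zeta]. The workload [w] stays a
    parameter, since its constancy has yet to be derived from this equation. *)
Definition invariant_balance (th : 'I_K -> M2 R) (w : R -> R) : Prop :=
  forall (k : 'I_K) (B : set (R * R)) (t : R),
    measurable B -> B `<=` @Rplus2 R -> 0 <= t ->
    (th k B = th k (shift B (t, t)) +
      (lam k)%:E * \int[lebesgue_measure]_(s in [set s : R | 0 <= s <= t]%R)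
        dplus_prod Gam (w s) k (shift B ((t - s)%R, (t - s)%R)))%E.

(** Substitutes the age [u = t - s] for the arrival time [s]. For [W > 0] the measure [delta^+] is
    the unit mass at [W]. *)
Lemma integral_dplus_prod k (W t : R) B : measurable B -> 0 < W ->
  (\int[lebesgue_measure]_(s in [set s : R | 0 <= s <= t]%R)
     dplus_prod Gam W k (shift B ((t - s)%R, (t - s)%R)) =
   \int[lebesgue_measure]_(u in [set u : R | 0 <= u <= t]%R)
     Gam k (diag_section B W u))%E.
Proof.
move=> mB W0; rewrite -[RHS](ge0_integral_reflection t); last 3 first.
- have -> : [set u : R | 0 <= u <= t] = `[0, t]%classic.
    by apply/seteqP; split => u /=; rewrite in_itv.
  exact: measurable_itv.
- exact: (measurable_fun_diag_section B (Gam k) W mB).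
- by [].
rewrite /dplus_prod W0; congr (integral _ _ _).
by apply/seteqP; split => s /= /andP[? ?]; apply/andP; split; lra.
Qed.

Section InvariantWorkload.
Context {th : 'I_K -> M2 R} {w : R -> R} {W : R}.
Hypothesis w_sol : workload_sol lam mu Gam w.
Hypothesis w_init : w 0 = W.
Hypothesis th_W : wtheta th = W%:E.
Hypothesis th_balance : invariant_balance th w.

Let quadrant_Rplus2 x : 0 <= x ->
  [set y | x <= y.1 /\ 0 <= y.2] `<=` @Rplus2 R.
Proof. by move=> x0 y /= [xy y0]; split => //; exact: le_trans xy. Qed.

(* If the workload were below [W] at time [t], work would have drained from every
   level in a left neighbourhood of [W] by then. *)
Lemma workload_ge_init t : 0 <= t -> W <= w t.
Proof.
move=> t0; rewrite leNgt; apply/negP => wtW.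
have t_gt0 : 0 < t.
  by rewrite lt_neqAle t0 andbT; apply/eqP => tE; move: wtW; rewrite -tE w_init ltxx.
(* The level [x] lies strictly between [m] and [W]. From [x > W - t], the half plane shifted by [t]
   lies above [W] and is null; from [x > w t], no arrival up to time [t] is still at level [x],
   because [w s - (t - s) <= w t]. *)
pose m := Num.max (w t) (W - t); pose x := (m + W) / 2.
have wt_ge0 : 0 <= w t by exact: w_sol.1.
have mw : w t <= m by rewrite /m le_max lexx.
have mWt : W - t <= m by rewrite /m le_max lexx orbT.
have mW : m < W by rewrite /m gt_max wtW/=; lra.
have [x0 wx xW xt] : [/\ 0 <= x, w t < x, x < W & W < x + t].
  by rewrite /x; split; lra.
have [k] := lt_wtheta th W x th_W x0 xW; apply.
have := th_balance k _ t (measurable_quadrant x 0) (quadrant_Rplus2 x x0) t0.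
move=> ->; rewrite integral0_eq ?mule0 ?adde0.
  have th0 := gt_wtheta th W k (x + t) th_W ltac:(lra) xt.
  apply: subset_measure0 th0; try exact: measurable_quadrant.
    rewrite (_ : shift _ _ = [set y : R * R | x + t <= y.1 /\ t <= y.2]).
      exact: measurable_quadrant.
    by apply/seteqP; split => y; rewrite /shift/= => -[? ?]; split; lra.
  by move=> y; rewrite /shift/= => -[? ?]; split; lra.
move=> s /= /andP[s0 st]; rewrite /dplus_prod; case: ifP => // _.
rewrite (_ : [set y | _] = set0) ?measure0//; apply/seteqP; split => y //.
rewrite /shift/= => -[h _].
by have := workload_sol_incr Gam_neg lam_gt0 mu_gt0 w s t w_sol s0 st; lra.
Qed.

(* If the workload exceeded [W] at time [t], then shortly afterwards there would be
   mass above level [W]. *)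
Lemma workload_le_init t : 0 <= t -> w t <= W.
Proof.
move=> t0; rewrite leNgt; apply/negP => wtW.
have W_ge0 : 0 <= W by rewrite -w_init; exact: w_sol.1.
case: (pickP (fun _ : 'I_K => true)) => [k _|no]; last first.
  by move: rho_gt1; rewrite big1 ?ltNge ?ler01// => k; have := no k.
(* [d] is small enough that [w t - d] still exceeds [W] and that a job of class [k] outlives [d]
   with positive probability. *)
have [d d0 [dW Gd]] : exists2 d, 0 < d & d < w t - W /\ 0 < Gsurv Gam k d.
  have [e /= e0 He] : \forall y \near (0 : R), 0 < Gsurv Gam k y.
    apply: (cvgr_gt _ (Gsurv_continuous Gam_neg Gam_atomless k 0)).
    by rewrite Gsurv_at0.
  pose m := Num.min e (w t - W).
  have m0 : 0 < m by rewrite /m lt_min e0/= subr_gt0.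
  have me : m <= e by rewrite /m ge_min lexx.
  have mW : m <= w t - W by rewrite /m ge_min lexx orbT.
  exists (m / 2); first lra; split; first lra.
  by apply: He; rewrite /ball/= sub0r normrN gtr0_norm; lra.
(* An arrival at [s] in [[t, t']] has first coordinate [w s - (t' - s) >= x] at time [t'], and its
   age is at most [d]. Such arrivals contribute at least [lam k * d * G k d] to a half plane that is
   null. *)
pose x := w t - d; pose t' := t + d.
have x0 : 0 <= x by rewrite /x; lra.
have t'0 : 0 <= t' by rewrite /t'; lra.
have thx0 := gt_wtheta th W k x th_W x0 ltac:(rewrite /x; lra).
have := th_balance k _ t' (measurable_quadrant x 0) (quadrant_Rplus2 x x0) t'0.
rewrite thx0 => /esym/eqP; rewrite padde_eq0; last 2 first.
- exact: measure_ge0.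
- apply: mule_ge0; first by rewrite lee_fin ltW.
  by apply: integral_ge0 => s _; rewrite /dplus_prod; case: ifP.
move=> /andP[_]; apply/negP; rewrite gt_eqF// mule_gt0 ?lte_fin//.
apply: (@lt_le_trans _ _ (\int[lebesgue_measure]_(s in `[t, t']) (Gsurv Gam k d)%:E)%E).
  rewrite integral_cst//= lebesgue_measure_itv/= lte_fin ifT /t'; last lra.
  by rewrite -EFinB mule_gt0 ?lte_fin//; lra.
apply: ge0_le_integral_nonmeasurable => s /=.
- by rewrite lee_fin ltW.
- by rewrite /dplus_prod; case: ifP.
rewrite in_itv/= => /andP[ts st']; split; first by apply/andP; split; lra.
have wst := workload_sol_incr Gam_neg lam_gt0 mu_gt0 w t s w_sol t0 ts.
have ws : x + (t' - s) <= w s by rewrite /x /t'; lra.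
rewrite /dplus_prod ifT; last by move: ws; rewrite /x; lra.
rewrite GsurvE//; apply: le_measure; rewrite ?inE//.
  rewrite (_ : [set y | _] = `[t' - s, +oo[%classic)//; apply/seteqP; split => y.
    by rewrite /shift/= in_itv/= andbT => -[_]; lra.
  by rewrite /shift/= in_itv/= andbT => ?; split; lra.
by move=> y; rewrite /shift/= in_itv/= andbT => dy; split; move: st' ws; rewrite /t'; lra.
Qed.

Lemma invariant_Ssum : 0 < W /\ Ssum lam mu Gam W = 1.
Proof.
have W_ge0 : 0 <= W by rewrite -w_init; exact: w_sol.1.
have wW t : 0 <= t -> w t = W.
  by move=> t0; apply/eqP; rewrite eq_le workload_le_init// workload_ge_init.
have SW : Ssum lam mu Gam W = 1 by apply/(workload_sol_cst w W wW W_ge0).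
split => //; rewrite lt_neqAle W_ge0 andbT; apply/eqP => W0.
by have := Ssum_at0 Gam_neg rho_gt1; rewrite W0 SW ltxx.
Qed.

Hypothesis th_M2K : is_M2K th.
Hypothesis th_lines : forall x, Rplus2 x -> thplus th (shift (@Cset R) x) = 0%E.

(** [wtheta] controls only the half planes strictly above [W]. The remaining boundary line is part
    of the axes shifted to [(W, 0)], which are null for states in [I]. *)
Lemma invariant_null k : th k [set y | W <= y.1 /\ 0 <= y.2] = 0%E.
Proof.
have [W0 _] := invariant_Ssum.
have mline : measurable (shift (@Cset R) (W, 0)).
  rewrite (_ : shift _ _ =
      (`[W, +oo[%classic `*` [set 0]) `|` ([set W] `*` `[0, +oo[%classic)).
    by apply: measurableU; apply: measurableX.
  apply/seteqP; split => -[u v]; rewrite /shift/Cset/= !in_itv/= !andbT.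
    by move=> [[? ?]|[? ?]]; [left|right]; split; lra.
  by move=> [[? ?]|[? ?]]; [left|right]; split; lra.
have line0 := thplus_eq0 _ _ (th_lines (W, 0) (conj (ltW W0) (lexx _))) k.
have mquad := measurable_quadrant W 0.
apply/(negligibleP _ mquad); apply: (@negligibleS _ _ _ _
  (shift (@Cset R) (W, 0) `|` \bigcup_n [set y | W + n.+1%:R^-1 <= y.1 /\ 0 <= y.2])).
  move=> y /= [Wy y0]; have [yW|yW] := leP y.1 W.
    by left; rewrite /shift/Cset/=; right; split; lra.
  right; have yW0 : 0 < y.1 - W by rewrite subr_gt0.
  have [n _ /(_ n (leqnn n))/= nr] := near_infty_natSinv_lt (PosNum yW0).
  by exists n => //; split => //; move: nr; move: (n.+1%:R^-1) => e; lra.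
apply: negligibleU; first exact/negligibleP.
apply: negligible_bigcup => n; apply/negligibleP; first exact: measurable_quadrant.
apply: (gt_wtheta th W) => //; last by rewrite ltrDl invr_gt0.
by rewrite addr_ge0// ltW.
Qed.

Lemma invariant_theta_w : is_theta_w lam Gam W th.
Proof.
have [W0 _] := invariant_Ssum.
split => // k; split => [|a b c d a0 ab bW c0 cd]; first exact: invariant_null.
rewrite -/(rectangle a b c d).
have mB := measurable_rectangle a b c d.
have t0 : 0 <= W - a by lra.
(* The time [W - a] is exactly what lifts the lower edge [a] of the rectangle to level [W]. *)
rewrite (th_balance k _ _ mB _ t0) => [|y [? [? [? ?]]]]; last by split; lra.
rewrite (_ : th k (shift _ _) = 0%E) ?add0e.
  congr (_ * _)%E.
  rewrite -(integral_diag_section_rectangle _ _ _ _ _ _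
    [set u : R | 0 <= u <= W - a]); last first.
    by move=> u ? ? /=; apply/andP; split; lra.
  rewrite -integral_dplus_prod//; apply: eq_integral => s /set_mem/= /andP[s0 _].
  congr (dplus_prod _ _ _ _).
  by apply/eqP; rewrite eq_le workload_le_init// workload_ge_init.
apply: (subset_measure0 _ _ _ (invariant_null k)).
- exact: measurable_shift.
- exact: measurable_quadrant.
- by move=> y; rewrite /shift/rectangle/= => -[? [? [? ?]]]; split; lra.
Qed.

End InvariantWorkload.
End InvariantStates.

(** * The measure obtained by integrating diagonal sections over ages *)

Section DiagonalMass.
Context {R : realType}.

(** The explicit form of [theta^w_k] up to the factor [lam k]. Intersecting with [Rplus2] makes it a
    measure on the whole plane and empties the sections with [u > w]. *)
Definition diag_mass (P : probability R R) (w : R) (A : set (R * R)) : \bar R :=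
  (\int[lebesgue_measure]_(u in `]0%R, +oo[)
     P (diag_section (A `&` @Rplus2 R) w u))%E.

Section Measure.
Variables (P : probability R R) (w : R).

Let diag_mass0 : diag_mass P w set0 = 0%E.
Proof.
by apply: integral0_eq => u _; rewrite set0I (_ : diag_section _ _ _ = set0).
Qed.

Let diag_mass_ge0 A : (0 <= diag_mass P w A)%E.
Proof. exact: integral_ge0. Qed.

(** Taking sections commutes with disjoint unions, and nonnegative series may be integrated term by
    term. *)
Let diag_mass_sigma_additive : semi_sigma_additive (diag_mass P w).
Proof.
move=> F mF tF _.
have mFR i : measurable (F i `&` @Rplus2 R).
  by apply: measurableI => //; exact: measurable_Rplus2.
rewrite [X in _ --> X](_ : _ = (\sum_(i <oo) diag_mass P w (F i))%E).
  by apply: is_cvg_ereal_nneg_natsum => i _; exact: diag_mass_ge0.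
rewrite /diag_mass -integral_nneseries//; last first.
  by move=> i; apply: measurable_funTS; exact: measurable_fun_diag_section.
apply: eq_integral => u _.
rewrite (_ : diag_section _ _ _ =
    \bigcup_i diag_section (F i `&` @Rplus2 R) w u); last first.
  by rewrite setI_bigcupl.
rewrite measure_bigcup//.
- by apply: eq_eseriesl => i; rewrite in_setT.
- by move=> i _; exact: measurable_diag_section.
- move=> i j _ _ [y [[Fiy _] [Fjy _]]].
  by apply: tF => //; exists (w - u, y - u).
Qed.

HB.instance Definition _ := isMeasure.Build _ _ _ (diag_mass P w)
  diag_mass0 diag_mass_ge0 diag_mass_sigma_additive.

End Measure.
End DiagonalMass.

(** * Every [theta^w] with [Ssum = 1] at [w] is invariant *)

Section ThetaW.
Context {R : realType} {K : nat} {Gam : 'I_K -> probability R R}.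
Context {lam mu : 'I_K -> R}.
Hypothesis lam_gt0 : forall k, 0 < lam k.
Hypothesis mu_gt0 : forall k, 0 < mu k.
Hypothesis Gam_neg : forall k, Gam k [set x : R | x <= 0] = 0%E.
Hypothesis Gam_atomless : forall k (x : R), Gam k [set x] = 0%E.
Context {th : 'I_K -> M2 R} {w : R}.
Hypothesis w_gt0 : 0 < w.
Hypothesis Sw : Ssum lam mu Gam w = 1.
Hypothesis th_w : is_theta_w lam Gam w th.

Let th_Rplus2 k (A : set (R * R)) : measurable A -> th k A = th k (A `&` @Rplus2 R).
Proof.
move=> mA; have mR := @measurable_Rplus2 R.
have mAR := measurableD mA mR.
rewrite -[in LHS](setUIDK A (@Rplus2 R)) measureU0//; first exact: measurableI.
by apply: (subset_measure0 _ _ _ (th_w.1 k)) => //; exact: measurableC.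
Qed.

(** Measures that agree on products of closed rays, and are finite on an exhausting sequence of
    them, are equal. Within [Rplus2] such a product is a quadrant: its part above level [w] is null,
    and the rest is a rectangle with [b = w] and [d = +oo], where the defining formula applies. *)
Lemma theta_w_diag_mass k (A : set (R * R)) : measurable A ->
  th k A = ((lam k)%:E * diag_mass (Gam k) w A)%E.
Proof.
move=> mA; pose l := NngNum (ltW (lam_gt0 k)).
rewrite -[RHS]/(mscale l (diag_mass (Gam k) w) A).
pose G : set (set (R * R)) :=
  [set A | exists x y : R, A = `[x, +oo[%classic `*` `[y, +oo[%classic].
pose g n : set (R * R) := `[- n%:R, +oo[%classic `*` `[- n%:R, +oo[%classic.
apply: (measure_unique G g) mA.
- exact: measurable_prod_rays.
- move=> _ _ [x [y ->]] [x' [y' ->]].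
  exists (Num.max x x'), (Num.max y y'); rewrite -setXI.
  by congr (_ `*` _); apply/seteqP; split => u /=;
    rewrite !in_itv/= !andbT ge_max => /andP.
- by move=> n; exists (- n%:R), (- n%:R).
- apply/seteqP; split => // -[x y] _.
  exists (Num.truncn (Num.max `|x| `|y|)).+1 => //=.
  have := truncnS_gt (Num.max `|x| `|y|); rewrite gt_max => /andP[hx hy].
  rewrite /g/= !in_itv/= !andbT; split; rewrite lerNl ltW//.
    by rewrite (le_lt_trans _ hx)// -normrN ler_norm.
  by rewrite (le_lt_trans _ hy)// -normrN ler_norm.
- move=> _ [x [y ->]]; rewrite -[RHS]/((lam k)%:E * diag_mass (Gam k) w _)%E.
  rewrite -[LHS]/(th k _) th_Rplus2; last exact: measurableX.
  pose a := Num.max x 0; pose c := Num.max y 0.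
  have a0 : 0 <= a by rewrite /a le_max lexx orbT.
  have c0 : 0 <= c by rewrite /c le_max lexx orbT.
  have AE : (`[x, +oo[%classic `*` `[y, +oo[%classic) `&` @Rplus2 R =
      [set z | a <= z.1 /\ c <= z.2].
    apply/seteqP; split => -[u v]; rewrite /Rplus2/= !in_itv/= !andbT /a /c !ge_max.
      by move=> [[-> ->] [-> ->]].
    by move=> [/andP[-> ->] /andP[-> ->]].
  have null : th k [set z | w <= z.1 /\ c <= z.2] = 0%E.
    apply: (subset_measure0 _ _ _ (th_w.2 k).1); try exact: measurable_quadrant.
    by move=> z /= [? ?]; split => //; lra.
  rewrite /diag_mass AE.
  (* For ages [u > 0] the bound [w - u < w] is automatic. *)
  have rectE : (\int[lebesgue_measure]_(u in `]0%R, +oo[)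
      Gam k (diag_section [set z | a <= z.1 /\ c <= z.2]%R w u) =
    \int[lebesgue_measure]_(u in `]0%R, +oo[)
      Gam k (diag_section (rectangle a w c +oo) w u))%E.
    apply: eq_integral => u /set_mem/=; rewrite in_itv/= andbT => u0.
    congr (Gam k _); apply/seteqP; split => z; rewrite /diag_section/rectangle/=.
      by move=> [? ?]; do !split => //; [lra|exact: ltry].
    by move=> [? [? [? ?]]].
  rewrite rectE; have [wa|aw] := leP w a.
    rewrite integral0_eq ?mule0 => [|u _]; last first.
      rewrite (_ : diag_section _ _ _ = set0) ?measure0//.
      by apply/seteqP; split => z //; rewrite /diag_section/rectangle/= => -[? [? _]]; lra.
    apply: subset_measure0 null; try exact: measurable_quadrant.
    by move=> z /= [? ?]; split => //; lra.
  rewrite integral_diag_section_rectangle; last first.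
    by move=> u; rewrite subrr /= in_itv/= andbT.
  rewrite -(th_w.2 k).2 ?ltry//.
  rewrite (_ : [set z | _ /\ _] = rectangle a w c +oo `|` [set z | w <= z.1 /\ c <= z.2]).
    by rewrite measureU0//; [exact: measurable_rectangle|exact: measurable_quadrant].
  apply/seteqP; split => z; rewrite /rectangle/=.
    move=> [? ?]; have [wz|wz] := leP w z.1; [by right|left].
    by do !split => //; exact: ltry.
  by move=> [[? [_ [? _]]]|[? ?]]; split => //; lra.
- by move=> n; rewrite ltey_eq fin_num_measure//; apply: measurableX.
Qed.

Lemma theta_wE k B : measurable B -> B `<=` @Rplus2 R ->
  (th k B = (lam k)%:E * \int[lebesgue_measure]_(u in `]0%R, +oo[)
     Gam k (diag_section B w u))%E.
Proof. by move=> mB BR; rewrite theta_w_diag_mass// /diag_mass setIidl. Qed.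

Lemma theta_w_balance : @invariant_balance R K Gam lam th (fun=> w).
Proof.
move=> k B t mB BR t0.
have BtR : shift B (t, t) `<=` @Rplus2 R.
  by move=> y; rewrite /shift => /BR; rewrite /Rplus2/= => -[? ?]; split; lra.
have mh := measurable_fun_diag_section B (Gam k) w mB.
rewrite integral_dplus_prod// theta_wE// (theta_wE k (shift _ _))//; last first.
  exact: measurable_shift.
rewrite -ge0_muleDr; try exact: integral_ge0; congr (_ * _)%E.
(* A section of the shifted set at age [u] is the section of [B] at age [u + t], so the shifted set
   collects the ages above [t], and the arrivals collect those in [[0, t]]. *)
have -> : (\int[lebesgue_measure]_(u in `]0%R, +oo[)
      Gam k (diag_section (shift B (t, t)) w u) =
    \int[lebesgue_measure]_(u in `]t, +oo[) Gam k (diag_section B w u))%E.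
  rewrite -[RHS](ge0_integral_translation t)//.
  rewrite [X in integral _ X _](_ : _ = [set u | `]t, +oo[%classic (u + t)]).
    apply: eq_integral => u _; congr (Gam k _).
    by apply/seteqP; split => y; rewrite /diag_section/shift/= !opprD !addrA.
  by apply/seteqP; split => u /=; rewrite !in_itv/= !andbT; lra.
rewrite addeC [X in (integral _ X _ + _)%E](_ : _ = `[0, t]%classic); last first.
  by apply/seteqP; split => u /=; rewrite in_itv.
rewrite -ge0_integral_setU//.
- rewrite integral_itv_obnd_cbnd; last exact: measurable_funTS.
  congr (integral _ _ _); apply/seteqP; split => u /=; rewrite !in_itv/= !andbT.
    by move=> u0; have [ut|ut] := leP u t; [left|right]; rewrite ?u0.
  by move=> [/andP[]|ut]//; lra.
- exact: measurable_funTS.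
- apply/disj_setPS => u /= []; rewrite !in_itv/= andbT => /andP[_ ut] tu.
  by move: tu; rewrite ltNge ut.
Qed.

Lemma exists_Gsurv_gt0 : exists k, 0 < Gsurv Gam k w.
Proof.
apply: contrapT => /forallNP G0; have : Ssum lam mu Gam w <= 0.
  apply: sumr_le0 => k _; apply: mulr_ge0_le0.
    by rewrite ltW// rho_gt0.
  by rewrite leNgt; apply/negP; exact: G0.
by rewrite Sw ler10.
Qed.

(** At age [u] the horizontal line is met in the single point [x2 + u], which is not an atom; the
    vertical line is met only at the single age [u = w - x1]. *)
Lemma theta_w_lines x : Rplus2 x -> thplus th (shift (@Cset R) x) = 0%E.
Proof.
case: x => x1 x2 [/= x10 x20]; rewrite /thplus big1// => k _.
have mC : measurable (shift (@Cset R) (x1, x2)).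
  apply: measurable_shift; rewrite (_ : @Cset R =
      (`[0, +oo[%classic `*` [set 0]) `|` ([set 0] `*` `[0, +oo[%classic)).
    by apply: measurableU; apply: measurableX.
  by apply/seteqP; split => -[u v]; rewrite /Cset/= !in_itv/= !andbT.
rewrite theta_wE//; last first.
  by move=> y; rewrite /shift/Cset/Rplus2/= => -[[? ?]|[? ?]]; split; lra.
rewrite (@ge0_negligible_integral _ _ _ lebesgue_measure _ [set w - x1])//; last 2 first.
- by apply: measurable_funTS; exact: measurable_fun_diag_section.
- exact: lebesgue_measure_set1.
rewrite integral0_eq ?mule0// => u /= [_ uw].
apply: (subset_measure0 _ _ _ (Gam_atomless k (x2 + u))) => //.
- exact: measurable_diag_section.
- move=> y; rewrite /diag_section/shift/Cset/= => -[[? ?]|[? ?]]; first lra.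
  by exfalso; apply: uw; lra.
Qed.

Lemma theta_w_wtheta : wtheta th = w%:E.
Proof.
apply/eqP; rewrite eq_le; apply/andP; split.
  apply: ge_ereal_sup => _ [x [x0 thx] <-]; rewrite lee_fin leNgt; apply/negP => wx.
  case: thx => [x00|]; first by move: wx w_gt0; rewrite x00; lra.
  rewrite /thplus big1 ?ltxx// => k _.
  apply: (subset_measure0 _ _ _ (th_w.2 k).1); try exact: measurable_quadrant.
  by move=> y /= [? ?]; split => //; lra.
rewrite leNgt; apply/negP => supw.
have sup0 : (0%:E <= wtheta th)%E.
  by apply: ereal_sup_ubound; exists 0 => //; split => //; left.
have supE : wtheta th = (fine (wtheta th))%:E.
  by rewrite fineK// fin_numE; apply/andP; split; apply/eqP => E;
    move: supw sup0; rewrite E.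
move: supw sup0; rewrite supE lte_fin lee_fin; set r := fine _ => rw r0.
(* If [wtheta] were [r < w], the midpoint [x] would be a level above [r] with positive mass: for
   every age [u <= w - x], all [y > w] lie in the section, which gives at least
   [lam k * (w - x) * G k w]. *)
have : (((r + w) / 2)%:E <= wtheta th)%E.
  apply: ereal_sup_ubound; exists ((r + w) / 2) => //; split; first lra.
  right; have [k Gk] := exists_Gsurv_gt0.
  rewrite /thplus (bigD1 k)//=; set x := (r + w) / 2.
  have [x0 xw] : 0 <= x /\ x < w by rewrite /x; split; lra.
  apply: lt_le_trans (leeDl _ _); last exact: sume_ge0.
  rewrite theta_wE; last 2 first.
  - exact: measurable_quadrant.
  - by move=> y /= [? ?]; split => //; lra.
  rewrite mule_gt0 ?lte_fin//.
  apply: (@lt_le_trans _ _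
    (\int[lebesgue_measure]_(u in `]0%R, (w - x)%R]) (Gsurv Gam k w)%:E)%E).
    rewrite integral_cst//= lebesgue_measure_itv/= lte_fin ifT ?subr_gt0//.
    by rewrite sube0 mule_gt0 ?lte_fin// subr_gt0.
  apply: ge0_le_integral_nonmeasurable => u //=; first by rewrite lee_fin ltW.
  rewrite !in_itv/= andbT => /andP[u0 uw]; split => //.
  rewrite GsurvE//; apply: le_measure; rewrite ?inE//.
    by apply: measurable_diag_section; exact: measurable_quadrant.
  by move=> y; rewrite /diag_section/= in_itv/= andbT => wy; split; lra.
by rewrite supE lee_fin -/r; lra.
Qed.

Lemma theta_w_inI : inI Gam th.
Proof.
split; first exact: th_w.1.
split; first exact: theta_w_lines.
rewrite theta_w_wtheta; split; first exact: ltry.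
move=> e e0 /=; have [k Gk] := exists_Gsurv_gt0; exists k.
by apply: lt_le_trans Gk _; apply: Gsurv_nonincreasing => //; lra.
Qed.

Lemma theta_w_invariant : invariant_state lam mu Gam th.
Proof.
split; first exact: theta_w_inI.
split=> [t _|]; first exact: th_w.1.
split => //; exists (fun=> w); split; last first.
  by split; [rewrite theta_w_wtheta|exact: theta_w_balance].
by apply/(workload_sol_cst _ w) => //; exact: ltW.
Qed.

End ThetaW.

Theorem theorem3p3 (R : realType) (K : nat) (lam mu : 'I_K -> R)
  (Gam : 'I_K -> probability R R)
  (hlam : forall k, 0 < lam k) (hmu : forall k, 0 < mu k)
  (hrho : 1 < \sum_(k < K) lam k / mu k)
  (hGsupp : forall k, Gam k [set x : R | x <= 0] = 0%E)
  (hGcont : forall k (x : R), Gam k [set x] = 0%E)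
  (hGmean : forall k, (\int[Gam k]_x `|x|%:E < +oo)%E)
  (theta : 'I_K -> M2 R) :
  invariant_state lam mu Gam theta <->
  exists w : R, w_low lam mu Gam <= w <= w_up lam mu Gam /\ is_theta_w lam Gam w theta.
Proof.
have w_lowP := w_low_up_Ssum hGsupp hGcont hlam hmu hrho.
split=> [[[thM [lines _]] [_ [_ [w [w_sol [w0 bal]]]]]]|[w [/w_lowP[w0 Sw] th_w]]].
  (* The initial workload equals [wtheta theta] by definition of a fluid solution. *)
  exists (w 0); split.
    apply/w_lowP.
    exact: (invariant_Ssum hlam hmu hrho hGsupp hGcont w_sol erefl (esym w0) bal).
  exact: (invariant_theta_w hlam hmu hrho hGsupp hGcont w_sol erefl (esym w0) bal).
exact: (theta_w_invariant hlam hmu hGsupp hGcont w0 Sw th_w).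
Qed.
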